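(* For every constant $c \in (0,1/2]$ there exist a positive integer $\ell$ bounded by a polynomial in $1/c$, and a constant $C_c>0$, such that for all sufficiently large $n$, $$\mathrm{ORS}_n(cn) \le C_c \cdot \frac{n}{\log^{(\ell)} n},$$ where $\log^{(\ell)}$ denotes the $\ell$-fold iterated logarithm.
   Context: For a matching $M$, $V(M)$ denotes the set of vertices matched by $M$. A sequence $M_1,\dots,M_t$ of pairwise edge-disjoint matchings is called ordered-induced if for every $i\in[t]$, $M_i$ is an induced matching of the graph with edge set $M_1\cup\dots\cup M_i$, i.e., no edge of $M_1\cup\cdots\cup M_{i-1}$ has both endpoints in $V(M_i)$. An $n$-vertex graph is an $\mathrm{ORS}_n(r,t)$ graph if its edge set is the union of an ordered-induced sequence of $t$ matchings, each of size exactly $r$. $\mathrm{ORS}_n(r)$ denotes the maximum $t$ for which an $\mathrm{ORS}_n(r,t)$ graph exists (for non-integer $r$, $r$ is replaced by $\lceil r\rceil$). *)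

(* Defs.v *)
From mathcomp Require Import all_boot.
From Stdlib Require Import Reals.

Set Implicit Arguments.
Unset Strict Implicit.
Unset Printing Implicit Defensive.

(* Edges of a simple graph on vertex set 'I_n are 2-element subsets. *)
Definition is_matching (n : nat) (M : {set {set 'I_n}}) : Prop :=
  (forall e, e \in M -> #|e| = 2) /\
  (forall e f, e \in M -> f \in M -> e != f -> [disjoint e & f]).

Definition matched_vertices (n : nat) (M : {set {set 'I_n}}) : {set 'I_n} :=
  \bigcup_(e in M) e.

Definition ordered_induced (n t : nat) (M : 'I_t -> {set {set 'I_n}}) : Prop :=
  (forall i, is_matching (M i)) /\
  (forall i j, i != j -> [disjoint M i & M j]) /\
  (forall i j : 'I_t, (j < i)%N ->
     forall e, e \in M j -> ~~ (e \subset matched_vertices (M i))).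

(* There is an ORS_n(r,t) graph: an n-vertex graph whose edge set is the
   union of an ordered-induced sequence of t matchings each of size exactly r. *)
Definition is_ORS (n r t : nat) : Prop :=
  exists M : 'I_t -> {set {set 'I_n}},
    ordered_induced M /\ (forall i, #|M i| = r).

Definition iter_log (l : nat) (x : R) : R := iter l ln x.

(* Main.v *)
(* If v is matched by M_i, then no neighbour of v along an edge of an earlier
   matching is matched by M_i. Suppose all n / L remaining matchings live on a
   vertex set W. Some initial segment J of them and some later batch S overlap
   a lot: the vertices covered often by J make up a positive proportion of each
   member of S. By averaging, some v lies in a positive proportion of S and has
   many J-neighbours not yet deleted; keep only the members of S matching v and
   delete the J-neighbours of v. After O(L) rounds a positive proportion
   (polynomial in c) of the n vertices is deleted, exp(O(L)) is lost in the
   number of matchings, and the surviving matchings keep their full size inside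
   W. So each step costs one exponential in L, and after poly(1/c) steps no
   vertex is left; hence L must be at least of the order of the corresponding
   iterated logarithm of n. *)
Require Import Defs.
From mathcomp Require Import all_boot zify.
From Stdlib Require Import Reals Lra.
From Stdlib Require Znat.

Set Implicit Arguments.
Unset Strict Implicit.
Unset Printing Implicit Defensive.

(* [Reals] rebinds this notation to [Nat.pow]. *)
Local Notation "m ^ n" := (expn m n) : nat_scope.

(** * Coverage and neighbourhoods in a sequence of matchings *)

Section Combinatorics.

Variable n : nat.
Implicit Types (A B : {set {set 'I_n}}) (s J S T : seq {set {set 'I_n}}).
Implicit Types (U W X Y : {set 'I_n}) (u v w : 'I_n).

Local Notation V := (@matched_vertices n).

(** The ordered-induced condition for [A] earlier than [B], as a boolean relation, so that
    [pairwise] can carry it to subsequences. *)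
Definition precedes A B := [forall e in A, ~~ (e \subset V B)].

Definition cov s v := count (fun A => v \in V A) s.

Definition heavy s a := [set v | a <= cov s v].

Definition nbr s v := [set w | has (fun A => [set v; w] \in A) s].

Lemma cardsUD X Y : #|X :|: Y| = #|X| + #|Y :\: X|.
Proof. by rewrite cardsU cardsD setIC addnBA ?subset_leq_card ?subsetIl. Qed.

Lemma nbr_sym s v w : (w \in nbr s v) = (v \in nbr s w).
Proof. by rewrite !inE; apply: eq_has => A; rewrite setUC. Qed.

Lemma cov_cat s1 s2 v : cov (s1 ++ s2) v = cov s1 v + cov s2 v.
Proof. by rewrite /cov count_cat. Qed.

Lemma card_matched A : is_matching A -> #|V A| = #|A| * 2.
Proof.
case=> A2 Adisj.
have trivA : trivIset A by apply/trivIsetP => e f; apply: Adisj.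
have -> : V A = cover A by [].
rewrite -(eqP trivA) -sum_nat_const; exact: eq_bigr.
Qed.

Lemma matched_partner A v :
  is_matching A -> v \in V A -> exists w, [set v; w] \in A.
Proof.
move=> [A2 _] /bigcupP[e eA ve].
have /cards2P[x [y [_ eE]]] : #|e| == 2 by rewrite A2.
move: ve eA; rewrite eE !inE => /orP[] /eqP -> eA; first by exists y.
by exists x; rewrite setUC.
Qed.

Lemma edge_matched A v w : [set v; w] \in A -> (v \in V A) && (w \in V A).
Proof.
move=> eA; apply/andP.
by split; apply/bigcupP; exists [set v; w]; rewrite // !inE eqxx ?orbT.
Qed.

Lemma partner_uniq A v w w' :
  is_matching A -> [set v; w] \in A -> [set v; w'] \in A -> w = w'.
Proof.
case=> A2 Adisj eA fA.
have [ef|ef] := eqVneq [set v; w] [set v; w']; last first.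
  have /pred0P/(_ v) := Adisj _ _ eA fA ef.
  by rewrite /= !inE eqxx.
have : w \in [set v; w'] by rewrite -ef !inE eqxx orbT.
rewrite !inE => /orP[/eqP wv|/eqP //].
by move: (A2 _ eA); rewrite wv setUid cards1.
Qed.

Lemma nbr_matched s v w : w \in nbr s v -> exists2 A, A \in s & w \in V A.
Proof. by rewrite inE => /hasP[A As /edge_matched/andP[_ wA]]; exists A. Qed.

(** A [J]-neighbour of [v] inside [V B] would put an edge of an earlier matching inside [V B]. Hence
    matchings that match [v] survive the deletion of [nbr J v]. *)
Lemma disjoint_nbr J B v :
  all (precedes^~ B) J -> v \in V B -> [disjoint V B & nbr J v].
Proof.
move=> /allP JB vB; rewrite disjoint_sym disjoint_subset.
apply/subsetP => w; rewrite inE => /hasP[A AJ eA]; apply/negP => wB.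
have /forallP/(_ [set v; w])/implyP/(_ eA)/negP := JB _ AJ; apply.
by apply/subsetP => x; rewrite !inE => /orP[] /eqP ->.
Qed.

Lemma card_nbr_le J v :
  (forall A, A \in J -> is_matching A) -> #|nbr J v| <= size J.
Proof.
elim: J => [_|A J IH mJ].
  by rewrite (_ : nbr _ _ = set0) ?cards0 //; apply/setP => w; rewrite !inE.
have -> : nbr (A :: J) v = [set w | [set v; w] \in A] :|: nbr J v.
  by apply/setP => w; rewrite !inE.
apply: leq_trans (leq_card_setU _ _) _; rewrite /= -add1n leq_add //.
  apply/card_le1_eqP => w w'; rewrite !inE => eA fA.
  by apply: partner_uniq eA; rewrite ?fA //; apply: mJ; rewrite mem_head.
by apply: IH => B BJ; apply: mJ; rewrite inE BJ orbT.
Qed.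

(** The partners of [v] in different members are distinct: an edge of [A] repeated in a later [B]
    would lie inside [V B]. *)
Lemma cov_le_card_nbr J v :
  (forall A, A \in J -> is_matching A) -> pairwise precedes J ->
  cov J v <= #|nbr J v|.
Proof.
elim: J => [//|A J IH] mJ /= /andP[AJ pJ].
have {}IH : cov J v <= #|nbr J v|.
  by apply: IH => // B BJ; apply: mJ; rewrite inE BJ orbT.
have sub : nbr J v \subset nbr (A :: J) v.
  by apply/subsetP => w; rewrite !inE /= => ->; rewrite orbT.
rewrite /cov /=; have [vA|_] := boolP (v \in V A); last first.
  exact: leq_trans IH (subset_leq_card sub).
have [w eA] := matched_partner (mJ _ (mem_head _ _)) vA.
rewrite add1n; apply: leq_ltn_trans IH _; apply: proper_card.
apply/properP; split=> //; exists w; first by rewrite inE /= eA.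
rewrite inE; apply/hasPn => B BJ; apply/negP => eB.
have /forallP/(_ [set v; w])/implyP/(_ eA)/negP := allP AJ _ BJ; apply.
have /andP[vB wB] := edge_matched eB.
by apply/subsetP => x; rewrite !inE => /orP[] /eqP ->.
Qed.

(** Double counting of incidences; the weight [f] is 1 when heavy vertices are counted and a degree
    when a vertex is chosen by averaging. *)
Lemma sum_cov T X (f : 'I_n -> nat) :
  \sum_(A <- T) \sum_(v in V A :&: X) f v = \sum_(v in X) cov T v * f v.
Proof.
elim: T => [|A T IH].
  by rewrite big_nil big1.
rewrite big_cons IH /cov /=.
under [RHS]eq_bigr do rewrite mulnDl.
rewrite big_split /=; congr (_ + _).
under eq_bigl do rewrite inE andbC.
rewrite big_mkcondr /=; apply: eq_bigr => v _.
by case: (v \in V A); rewrite ?mul1n ?mul0n.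
Qed.

Lemma leq_sum_seq_const T a (F : {set {set 'I_n}} -> nat) :
  (forall A, A \in T -> a <= F A) -> size T * a <= \sum_(A <- T) F A.
Proof.
elim: T => [|A T IH] aF; first by rewrite big_nil.
rewrite big_cons /= mulSn leq_add ?aF ?mem_head //.
by apply: IH => B BT; rewrite aF // inE BT orbT.
Qed.

(** * Heavy vertices and the split into early and late matchings *)

Variables D a : nat.
Hypotheses (D0 : 0 < D) (a0 : 0 < a) (n0 : 0 < n).

(** There are at least [2 * a * n] incidences outside [X]. Light vertices absorb at most [a * n] of
    them, and a heavy vertex at most [8 * D * a]. *)
Lemma card_heavy_outside T X :
  size T <= 8 * D * a -> 8 * D * a <= 2 * size T ->
  (forall A, A \in T -> n <= 2 * D * #|V A :\: X|) ->
  n <= 8 * D * #|heavy T a :\: X|.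
Proof.
move=> T1 T2 big.
have low : size T * n <= 2 * D * \sum_(A <- T) #|V A :\: X|.
  by rewrite big_distrr /=; apply: leq_sum_seq_const.
have up : \sum_(A <- T) #|V A :\: X| <= #|heavy T a :\: X| * (8 * D * a) + n * a.
  have -> : \sum_(A <- T) #|V A :\: X| = \sum_(v in ~: X) cov T v.
    transitivity (\sum_(A <- T) \sum_(v in V A :&: ~: X) 1).
      by apply: eq_bigr => A _; rewrite sum1_card setDE.
    by rewrite sum_cov; apply: eq_bigr => v _; rewrite muln1.
  rewrite (bigID (mem (heavy T a))) /= leq_add //.
    rewrite -sum_nat_const [leqRHS](eq_bigl (fun v => (v \in ~: X) && (v \in heavy T a))).
      by apply: leq_sum => v _; apply: leq_trans (count_size _ _) T1.
    by move=> v; rewrite !inE.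
  rewrite -[X in _ <= X * _]card_ord -sum_nat_const big_mkcond /=.
  apply: leq_sum => v _; case: ifP => //; rewrite !inE -ltnNge => /andP[_].
  exact: ltnW.
nia.
Qed.

(* Cut s into k blocks: as long as the current block overlaps little with the
   vertices heavy for the earlier ones, it creates many new heavy vertices. *)
Lemma heavy_split k s :
  size s = k * (8 * D * a) ->
  (forall A, A \in s -> n <= D * #|V A|) ->
  (exists J S, [/\ subseq (J ++ S) s, 4 * D * a <= size S &
     forall A, A \in S -> n <= 2 * D * #|V A :&: heavy J a|])
  \/ k * n <= 8 * D * #|heavy s a|.
Proof.
elim: k s => [|k IH] s sz big; first by right.
set b := 8 * D * a in sz IH *.
have sE := cat_take_drop (k * b) s.
set s0 := take _ s in sE; set s1 := drop _ s in sE.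
have sz0 : size s0 = k * b by rewrite size_takel // sz mulSn leq_addl.
have sz1 : size s1 = b by rewrite size_drop sz mulSn addnK.
have [||[J [S [sub szS SJ]]]|IHs] := IH s0.
- by [].
- by move=> A As; apply: big; rewrite -sE mem_cat As.
- left; exists J, S; split=> //; apply: subseq_trans sub _.
  by rewrite -sE prefix_subseq.
set P := heavy s0 a in IHs.
pose p A := n <= 2 * D * #|V A :&: P|.
have cnt : count p s1 + count (predC p) s1 = b by rewrite count_predC.
(* If half of the last block overlaps [P], that half is [S] and all earlier blocks are [J].
   Otherwise the other half makes at least [n / (8 * D)] new vertices heavy. *)
have [half|half] := leqP (4 * D * a) (count p s1).
  left; exists s0, (filter p s1); split.
  - by rewrite -sE cat_subseq ?filter_subseq.
  - by rewrite size_filter.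
  - by move=> A; rewrite mem_filter => /andP[].
right; pose T := filter (predC p) s1.
have := @card_heavy_outside T P.
rewrite size_filter => /(_ _ _ _) H.
have {}H : n <= 8 * D * #|heavy T a :\: P|.
  apply: H; [lia | lia |] => A; rewrite mem_filter /= -ltnNge => /andP[lt As].
  have := big A; rewrite -sE mem_cat As orbT => /(_ isT).
  rewrite -(cardsID P); move: lt; move: #|_ :&: _| #|_ :\: _| => x y.
  by clear; nia.
have sub : P :|: heavy T a \subset heavy s a.
  apply/subsetP => v; rewrite !inE -sE cov_cat.
  case/orP => le; first exact: leq_trans le (leq_addr _ _).
  apply: leq_trans le (leq_trans _ (leq_addl _ _)).
  by rewrite /cov count_filter; apply: sub_count => ? /andP[].
have := subset_leq_card sub; rewrite cardsUD.
move: IHs H; move: #|P| #|_ :\: _| #|_| => x y z; clear; nia.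
Qed.

(** * Greedy deletion of neighbourhoods *)

Variable Q : nat.
Local Notation E := (8 * D * Q).
Variables (J : seq {set {set 'I_n}}) (W : {set 'I_n}).
Hypotheses (mJ : forall A, A \in J -> is_matching A)
  (pJ : pairwise precedes J) (szJ : size J <= 2 * Q * a)
  (JW : forall A, A \in J -> V A \subset W).

(** The heavy vertices of [A] have total degree at least [a * n / (2 * D)]. Degrees are at most
    [2 * Q * a], so a set [U] of size at most [n / E] takes away at most half of it. *)
Lemma sum_nbr_outside A U :
  E * #|U| <= n -> n <= 2 * D * #|V A :&: heavy J a| ->
  a * n <= 4 * D * \sum_(v in V A) #|nbr J v :\: U|.
Proof.
move=> Un big.
have h1 : a * #|V A :&: heavy J a| <= \sum_(v in V A) #|nbr J v|.
  rewrite mulnC -sum_nat_const big_mkcond [leqRHS]big_mkcond /=.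
  apply: leq_sum => v _; rewrite !inE; case: (v \in V A) => //=.
  case: ifP => // le; exact: leq_trans le (cov_le_card_nbr _ mJ pJ).
have h2 : \sum_(v in V A) #|nbr J v :&: U| <= #|U| * (2 * Q * a).
  have -> : \sum_(v in V A) #|nbr J v :&: U|
          = \sum_(u in U) #|nbr J u :&: V A|.
    under eq_bigr do rewrite -sum1_card.
    rewrite (exchange_big_dep (mem U)) /=; last by move=> v u _; rewrite inE => /andP[].
    apply: eq_bigr => u uU; rewrite -sum1_card; apply: eq_bigl => v.
    by rewrite !in_setI uU andbT nbr_sym andbC.
  rewrite -sum_nat_const; apply: leq_sum => u _.
  apply: leq_trans (subset_leq_card (subsetIl _ _)) _.
  exact: leq_trans (card_nbr_le _ mJ) szJ.
have h3 : \sum_(v in V A) #|nbr J v| = \sum_(v in V A) #|nbr J v :&: U|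
    + \sum_(v in V A) #|nbr J v :\: U|.
  by rewrite -big_split /=; apply: eq_bigr => v _; rewrite cardsID.
have h4 : a * n <= 2 * D * (a * #|V A :&: heavy J a|) by nia.
have h5 : 4 * D * (#|U| * (2 * Q * a)) <= a * n by nia.
nia.
Qed.

Lemma greedy_vertex S U :
  E * #|U| <= n ->
  (forall A, A \in S -> n <= 2 * D * #|V A :&: heavy J a|) ->
  exists v, size S * a <= 4 * D * (cov S v * #|nbr J v :\: U|).
Proof.
move=> Un big.
apply/existsP; apply: contraTT isT; rewrite negb_exists => /forallP none.
have low : size S * (a * n) <=
    4 * D * \sum_(v : 'I_n) cov S v * #|nbr J v :\: U|.
  have -> : \sum_v cov S v * #|nbr J v :\: U|
      = \sum_(A <- S) \sum_(v in V A) #|nbr J v :\: U|.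
    transitivity (\sum_(v in [set: 'I_n]) cov S v * #|nbr J v :\: U|).
      by apply: eq_bigl => v; rewrite inE.
    by rewrite -sum_cov; apply: eq_bigr => A _; rewrite setIT.
  rewrite big_distrr /=; apply: leq_sum_seq_const => A AS.
  by apply: sum_nbr_outside => //; apply: big.
(* Each failure is a strict inequality, written with a successor; summing over all [v] leaves a
   surplus of [n], which contradicts [low]. *)
have : \sum_(v : 'I_n) (4 * D * (cov S v * #|nbr J v :\: U|)).+1
    <= n * (size S * a).
  rewrite -[X in _ <= X * _]card_ord -sum_nat_const; apply: leq_sum => v _.
  by rewrite ltnNge none.
under eq_bigr do rewrite -addn1.
rewrite big_split /= sum_nat_const card_ord -big_distrr /= muln1 => up.
have : n * (size S * a) <= size S * (a * n) by rewrite mulnC mulnA.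
move=> /(leq_trans up)/leq_trans/(_ low).
by rewrite -[leqRHS]addn0 leq_add2l leqn0 eqn0Ngt n0.

Qed.

(** One round picks [v] by averaging, keeps the members matching [v] and adds [nbr J v] to [U].
    Averaging works only while [E * #|U| <= n]; once [U] is larger, nothing more is done. *)
Lemma greedy_deletion k S :
  0 < Q -> 0 < size S ->
  (forall A, A \in S -> all (precedes^~ A) J) ->
  (forall A, A \in S -> n <= 2 * D * #|V A :&: heavy J a|) ->
  exists S' U, [/\ subseq S' S, U \subset W,
    forall A, A \in S' -> [disjoint V A & U], size S <= size S' * E ^ k &
    n <= E * #|U| \/ k * a <= 4 * D * #|U|].
Proof.
move=> Q0 S0 JS big; elim: k => [|k [S' [U [sub UW dis sz H]]]].
  exists S, set0; split; rewrite ?sub0set ?muln1 //; last by right.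
  by move=> A _; rewrite disjoint_sym -setI_eq0 set0I.
have [Un|Un] := leqP n (E * #|U|).
  exists S', U; split=> //; last by left.
  by apply: leq_trans sz _; rewrite leq_mul2l expnS leq_pmull ?orbT //; nia.
case: H => H; first by rewrite leqNgt Un in H.
have [|v Hv] := @greedy_vertex S' U (ltnW Un).
  by move=> A AS; apply: big; apply: mem_subseq AS.
exists (filter (fun A => v \in V A) S'), (U :|: nbr J v); split.
- exact: subseq_trans (filter_subseq _ _) sub.
- rewrite subUset UW; apply/subsetP => w /nbr_matched[A AJ].
  by apply/subsetP/JW.
- move=> A; rewrite mem_filter => /andP[vA AS].
  have := disjoint_nbr (JS _ (mem_subseq sub AS)) vA.
  by rewrite -!setI_eq0 setIUr setU_eq0 !setI_eq0 dis.
- rewrite size_filter -/(cov S' v); apply: leq_trans sz _.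
  rewrite expnS mulnA leq_mul2r; apply/orP; right.
  (* The degree bound turns the averaged product into [size S' <= E * cov S' v]: one factor [E] is
     lost per round. *)
  have h : #|nbr J v :\: U| <= 2 * Q * a.
    apply: leq_trans (subset_leq_card (subsetDl _ _)) _.
    exact: leq_trans (card_nbr_le _ mJ) szJ.
  rewrite -(leq_pmul2r a0); apply: leq_trans Hv _.
  apply: leq_trans (_ : 4 * D * (cov S' v * (2 * Q * a)) <= _).
    by rewrite !leq_mul2l h !orbT.
  by apply: eq_leq; lia.
- right; rewrite cardsUD.
  have S'0 : 0 < size S' by case: (size S') sz => //; rewrite leqNgt S0.
  (* Conversely, [cov S' v <= size S'] shows that the round deletes at least [a / (4 * D)] new
     vertices. *)
  suff step : a <= 4 * D * #|nbr J v :\: U|.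
    by rewrite mulSn mulnDr addnC leq_add.
  rewrite -(leq_pmul2l S'0); apply: leq_trans Hv _.
  have := count_size (fun A => v \in V A) S'; rewrite -/(cov S' v) => h.
  by rewrite mulnCA leq_mul2r h orbT.
Qed.

End Combinatorics.

Lemma deletion_step n D (s : seq {set {set 'I_n}}) (W : {set 'I_n}) :
  let Q := 8 * D * (8 * D).+1 in
  0 < D -> 0 < n -> Q <= size s -> pairwise (@precedes n) s ->
  (forall A, A \in s -> [/\ is_matching A, matched_vertices A \subset W &
     n <= D * #|matched_vertices A|]) ->
  exists s' (U : {set 'I_n}), [/\ subseq s' s, U \subset W, n <= 8 * D * Q * #|U|,
    forall A, A \in s' -> matched_vertices A \subset W :\: U &
    size s %/ Q <= size s' * (8 * D * Q) ^ (n %/ (size s %/ Q)).+1].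
Proof.
move=> Q D0 n0 szs ps hs.
have Q0 : 0 < Q by rewrite /Q; lia.
set a := size s %/ Q.
have a0 : 0 < a by rewrite divn_gt0.
have aQ : Q * a <= size s by rewrite mulnC leq_divM.
have sa : size s <= 2 * Q * a.
  have := ltn_ceil (size s) Q0; rewrite -/a; nia.
(* [Q] is chosen so that [8 * D + 1] blocks of length [8 * D * a] fit into [s]. *)
have szb : size (take ((8 * D).+1 * (8 * D * a)) s) = (8 * D).+1 * (8 * D * a).
  by rewrite size_takel //; apply: leq_trans aQ; rewrite /Q; apply: eq_leq; lia.
have [A /mem_take As|[J [S [sub szS SJ]]]|] := heavy_split D0 a0 n0 szb.
- by have [] := hs _ As.
- have {}sub : subseq (J ++ S) s by apply: subseq_trans sub (take_subseq _ _).
  have sJ : subseq J s by apply: subseq_trans sub; apply: prefix_subseq.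
  have sS : subseq S s by apply: subseq_trans sub; apply: suffix_subseq.
  have := subseq_pairwise sub ps; rewrite pairwise_cat => /and3P[/allrelP JS pJ _].
  have mJ A : A \in J -> is_matching A by move/(mem_subseq sJ)/hs => [].
  have JW A : A \in J -> matched_vertices A \subset W by move/(mem_subseq sJ)/hs => [].
  have szJ : size J <= 2 * Q * a by apply: leq_trans sa; apply: size_subseq.
  have aS : a <= size S by apply: leq_trans szS; rewrite leq_pmull // muln_gt0.
  have JS' A : A \in S -> all ((@precedes n)^~ A) J.
    by move=> AS; apply/allP => B BJ; apply: JS.
  (* With [n %/ a + 1] rounds, [k * a] exceeds [n], so both outcomes make [U] a positive proportion
     of the vertices. *)
  have [S' [U [sub' UW dis sz H]]] := greedy_deletion D0 a0 n0 mJ pJ szJ JW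
    (n %/ a).+1 Q0 (leq_trans a0 aS) JS' SJ.
  exists S', U; split=> //.
  + exact: subseq_trans sub' sS.
  + case: H => // H; have nk : n <= (n %/ a).+1 * a by apply/ltnW/ltn_ceil.
    apply: leq_trans nk (leq_trans H _); rewrite leq_mul2r; apply/orP; right.
    by rewrite /Q; nia.
  + move=> A AS; rewrite subsetD dis // andbT.
    by have [] := hs _ (mem_subseq sS (mem_subseq sub' AS)).
  + exact: leq_trans aS sz.
(* With [8 * D + 1] blocks, the second outcome of the split would need more than [n] heavy
   vertices. *)
- move=> H; have := max_card (heavy (take ((8 * D).+1 * (8 * D * a)) s) a).
  by rewrite card_ord; nia.
Qed.

(** * Iterated logarithms and the repeated deletion step *)

Section Growth.

Local Open Scope R_scope.

Lemma ln_le x y : 0 < x -> x <= y -> ln x <= ln y.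
Proof. by move=> x0 [/(ln_increasing _ _ x0)/Rlt_le //|<-]; apply: Rle_refl. Qed.

Lemma exp_le x y : x <= y -> exp x <= exp y.
Proof. by move=> [/exp_increasing/Rlt_le //|<-]; apply: Rle_refl. Qed.

(** With [a = m %/ Q], the number of rounds is at most [2 * Q * L + 1], so the loss is exponential
    in [L]. The constant depends only on [Q] and [E]. *)
Lemma exp_deletion_growth (Q E : nat) : (0 < Q)%nat -> (0 < E)%nat ->
  exists A, 0 < A /\ forall L n m m', 1 <= L -> INR n <= INR m * L ->
  (Q <= m)%nat -> (m %/ Q <= m' * E ^ (n %/ (m %/ Q)).+1)%nat ->
  INR n <= INR m' * exp (A * L).
Proof.
move=> Q0 E0.
have Q1 : 1 <= INR Q by apply: (le_INR 1); lia.
have E1 : 1 <= INR E by apply: (le_INR 1); lia.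
have lnE : 0 <= ln (INR E) by rewrite -ln_1; apply: ln_le; lra.
exists (2 * INR Q + (2 * INR Q + 1) * ln (INR E)); split; first by nra.
move=> L n m m' L1 nm Qm.
set a := (m %/ Q)%nat => am.
have a0 : (0 < a)%nat by rewrite divn_gt0.
have a1 : 1 <= INR a by apply: (le_INR 1); lia.
have ma : INR m <= 2 * INR Q * INR a.
  have /leP/le_INR : (m <= 2 * Q * a)%nat by have := ltn_ceil m Q0; rewrite -/a; nia.
  by rewrite !mult_INR.
have na : INR n <= 2 * INR Q * L * INR a by nra.
set j := (n %/ a)%nat.
have ja : INR j <= 2 * INR Q * L.
  apply: (Rmult_le_reg_r (INR a)); first lra.
  rewrite -mult_INR; apply: Rle_trans na; apply/le_INR/leP; exact: leq_divM.
have Ej k : INR (E ^ k)%nat = exp (INR k * ln (INR E)).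
  elim: k => [|k IH]; first by rewrite /= Rmult_0_l exp_0.
  rewrite expnS mult_INR IH S_INR Rmult_plus_distr_r Rmult_1_l exp_plus.
  by rewrite exp_ln; lra.
have aR : INR a <= INR m' * exp (INR j.+1 * ln (INR E)).
  by rewrite -Ej -mult_INR; apply/le_INR/leP.
have m'0 := pos_INR m'.
apply: Rle_trans na _.
(* The linear factor is also absorbed into an exponential; the extra round is absorbed using
   [1 <= L]. *)
have e1 : 2 * INR Q * L <= exp (2 * INR Q * L).
  by have := exp_ineq1_le (2 * INR Q * L); lra.
have e2 : exp (INR j.+1 * ln (INR E)) <= exp ((2 * INR Q + 1) * ln (INR E) * L).
  apply: exp_le; rewrite S_INR.
  have : INR j + 1 <= (2 * INR Q + 1) * L by lra.
  by move=> h; have := Rmult_le_compat_r _ _ _ lnE h; lra.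
rewrite Rmult_plus_distr_r exp_plus.
apply: Rle_trans (_ : exp (2 * INR Q * L) * (INR m' * exp (INR j.+1 * ln (INR E))) <= _).
  by apply: Rmult_le_compat => //; nra.
have p := exp_pos (2 * INR Q * L).
rewrite (Rmult_comm (INR m')) -Rmult_assoc (Rmult_comm (INR m')).
apply: Rmult_le_compat_r => //; apply: Rmult_le_compat_l => //; lra.
Qed.

Lemma iter_log_large (B : R) l :
  exists X, forall x, X <= x -> forall j, (j <= l)%nat -> B <= iter_log j x.
Proof.
elim: l => [|l [X IH]].
  by exists B => x Bx j; rewrite leqn0 => /eqP ->.
exists (Rmax B (exp X)) => x hx [|j] jl.
  exact: Rle_trans (Rmax_l _ _) hx.
rewrite /iter_log iterSr; apply: IH => //.
rewrite -[X]ln_exp; apply: ln_le; first exact: exp_pos.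
exact: Rle_trans (Rmax_r _ _) hx.
Qed.

Lemma iter_log_le n l j :
  (forall i, (i <= l)%nat -> 0 < iter_log i (INR n)) ->
  (j <= l)%nat -> iter_log j (INR n) <= INR n.
Proof.
move=> large; elim: j => [_|j IH jl]; first exact: Rle_refl.
apply: Rle_trans (IH (ltnW jl)).
have pos := large _ (ltnW jl).
have := exp_ineq1_le (iter_log j.+1 (INR n)).
have -> : exp (iter_log j.+1 (INR n)) = iter_log j (INR n) by apply: exp_ln.
lra.
Qed.

(** Write [x] for the [j]-th iterate. As [A / C <= 1 / 2], the left side is at most the square root
    of [x], which is at most [x / C] because [x >= C * C]. *)
Lemma exp_iter_log n l j A C :
  0 < A -> 2 * A <= C -> 1 <= C ->
  (forall i, (i <= l)%nat -> C * C <= iter_log i (INR n)) -> (j < l)%nat ->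
  exp (A * (iter_log j.+1 (INR n) / C)) <= iter_log j (INR n) / C.
Proof.
move=> A0 AC C1 large jl.
have jC := large _ (ltnW jl); have pos : 0 < iter_log j (INR n) by nra.
set y := iter_log j.+1 (INR n).
have y0 : 0 < y by have := large _ jl; rewrite -/y; nra.
have xE : iter_log j (INR n) = exp (y / 2) * exp (y / 2).
  by rewrite -exp_plus -[iter_log j _]exp_ln //; congr exp; rewrite /y /iter_log /=; field.
have p := exp_pos (y / 2).
apply: Rle_trans (_ : exp (y / 2) <= _).
  apply: exp_le; apply: (Rmult_le_reg_r C); first lra.
  have -> : A * (y / C) * C = A * y by field; lra.
  by nra.
rewrite xE in jC *; apply: (Rmult_le_reg_r C); first lra.
have -> : exp (y / 2) * exp (y / 2) / C * C = exp (y / 2) * exp (y / 2) by field; lra.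
by apply: Rmult_le_compat_l; nra.
Qed.


Lemma no_dense_sequence n D (s : seq {set {set 'I_n}}) A C :
  let Q := (8 * D * (8 * D).+1)%nat in let E := (8 * D * Q)%nat in
  (0 < D)%nat -> (0 < n)%nat -> 0 < A -> 2 * A <= C -> 1 <= C -> INR Q <= C ->
  (forall j, (j <= E)%nat -> C * C <= iter_log j (INR n)) ->
  (forall L n m m', 1 <= L -> INR n <= INR m * L ->
    (Q <= m)%nat -> (m %/ Q <= m' * E ^ (n %/ (m %/ Q)).+1)%nat ->
    INR n <= INR m' * exp (A * L)) ->
  pairwise (@precedes n) s ->
  (forall M, M \in s -> is_matching M /\ (n <= D * #|matched_vertices M|)%nat) ->
  ~ INR n <= INR (size s) * (iter_log E (INR n) / C).
Proof.
move=> Q E D0 n0 A0 AC C1 QC large growth ps hs dense.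
have n1 : 0 < INR n by apply: (lt_INR 0); lia.
(* Invariant: each step removes at least [n / E] vertices from [W] and trades one logarithm in the
   density bound. *)
have state k : (k <= E)%nat -> exists s' (W : {set 'I_n}), [/\ subseq s' s,
    forall M, M \in s' -> matched_vertices M \subset W,
    (k * n + E * #|W| <= E * n)%nat &
    INR n <= INR (size s') * (iter_log (E - k) (INR n) / C)].
  elim: k => [_|k IH kE].
    by exists s, setT; split; rewrite ?subn0 ?cardsT ?card_ord.
  have [s' [W [sub sW cW dn]]] := IH (ltnW kE).
  set L := iter_log (E - k) (INR n) / C in dn.
  have Ek : (E - k <= E)%nat by apply: leq_subr.
  have L1 : 1 <= L.
    apply: (Rmult_le_reg_r C); first lra.
    have -> : L * C = iter_log (E - k) (INR n) by rewrite /L; field; lra.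
    by have := large _ Ek; nra.
  (* Since [L <= n / C], the density bound leaves at least [C >= Q] matchings. *)
  have Qs : (Q <= size s')%nat.
    apply/leP/INR_le; apply: Rle_trans QC _; apply: (Rmult_le_reg_r (INR n)) => //.
    have LC : L * C <= INR n.
      have -> : L * C = iter_log (E - k) (INR n) by rewrite /L; field; lra.
      by apply: iter_log_le Ek => i iE; have := large _ iE; nra.
    have := pos_INR (size s'); nra.
  have [|M Ms|s1 [U [sub1 UW cU s1W sz]]] := deletion_step D0 n0 Qs (W := W).
  - exact: subseq_pairwise sub ps.
  - by have [mM nM] := hs _ (mem_subseq sub Ms); split=> //; apply: sW.
  exists s1, (W :\: U); split=> //.
  - exact: subseq_trans sub1 sub.
  - rewrite mulSn -addnA addnCA; apply: leq_trans cW; rewrite leq_add2l.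
    by rewrite -(cardsID U W) (setIidPr UW) mulnDr leq_add2r.
  - apply: Rle_trans (growth _ _ _ _ L1 dn Qs sz) _.
    apply: Rmult_le_compat_l; first exact: pos_INR.
    have EkS : (E - k = (E - k.+1).+1)%nat by rewrite subnS prednK // subn_gt0.
    rewrite /L EkS; apply: (exp_iter_log A0 AC C1 large); lia.
(* After [E] steps [W] is empty, yet the density bound still leaves a matching, which covers at
   least [n / D] vertices. *)
have [s' [W [sub sW cW dn]]] := state _ (leqnn E).
have E0 : (0 < E)%nat by rewrite /E /Q; lia.
have W0 : #|W| = 0%nat.
  by apply/eqP; move: cW; rewrite -[leqRHS]addn0 leq_add2l leqn0 muln_eq0 eqn0Ngt E0.
case: s' sub sW dn => [|M s'] sub sW dn; first by move: dn => /=; lra.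
have [_ nM] := hs _ (mem_subseq sub (mem_head _ _)).
have := subset_leq_card (sW _ (mem_head _ _)); rewrite W0 leqn0 => /eqP M0.
by move: nM; rewrite M0 muln0 leqNgt n0.
Qed.

Lemma exists_INR_between x : 0 <= x -> exists D, x <= INR D /\ INR D <= x + 1.
Proof.
move=> x0; have [up1 up2] := archimed x.
exists (Z.to_nat (up x)); rewrite INR_IZR_INZ Znat.Z2Nat.id; first lra.
by apply: le_IZR; lra.
Qed.

End Growth.

(** * From ordered-induced families to the bound on ORS *)

Lemma pairwise_precedes n t (M : 'I_t -> {set {set 'I_n}}) :
  ordered_induced M -> pairwise (@precedes n) [seq M i | i <- enum 'I_t].
Proof.
case=> _ [_ ind]; rewrite pairwise_map.
have : pairwise ltn (map val (enum 'I_t)).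
  by rewrite val_enum_ord -sorted_pairwise ?iota_ltn_sorted //; apply: ltn_trans.
rewrite pairwise_map; apply: sub_pairwise => i j /= ij.
by apply/forallP => e; apply/implyP; apply: ind.
Qed.

Theorem theorem1p2 :
  exists (K d : nat),
  forall c : R, (0 < c)%R -> (c <= / 2)%R ->
  exists l : nat, (0 < l)%N /\ (INR l <= INR K * (/ c) ^ d)%R /\
  exists C : R, (0 < C)%R /\
  exists N : nat, forall n : nat, (N <= n)%N ->
  forall r : nat, (INR r - 1 < c * INR n)%R -> (c * INR n <= INR r)%R ->
  forall t : nat, is_ORS n r t ->
  (INR t <= C * (INR n / iter_log l (INR n)))%R.
Proof.
(* The depth is [E <= 576 * D ^ 3] with [D <= / c + 1 <= 2 * / c], and [4608 = 576 * 8]. *)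
exists 4608, 3 => c c0 c2.
have ic : (2 <= / c)%R.
  by rewrite -[2%R]Rinv_inv; apply: Rinv_le_contravar.
have [D [cD Dc]] : exists D, (/ c <= INR D /\ INR D <= / c + 1)%R.
  by apply: exists_INR_between; lra.
have D0 : 0 < D by apply/ltP/INR_lt => /=; lra.
set Q := 8 * D * (8 * D).+1; set E := 8 * D * Q.
have Q0 : 0 < Q by rewrite /Q; lia.
have E0 : 0 < E by rewrite /E muln_gt0 Q0; lia.
exists E; split=> //; split.
  have /leP/le_INR : E <= 576 * (D * D * D) by rewrite /E /Q; nia.
  rewrite !mult_INR => h; apply: Rle_trans h _.
  have -> : INR 4608 = (INR 576 * 8)%R by rewrite !INR_IZR_INZ /= -mult_IZR.
  rewrite (Rmult_assoc (INR 576)); apply: Rmult_le_compat_l; first exact: pos_INR.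
  apply: Rle_trans (_ : (2 * / c) * (2 * / c) * (2 * / c) <= _)%R; last first.
    by rewrite /=; lra.
  have D1 := pos_INR D.
  by repeat apply: Rmult_le_compat; try lra; apply: Rmult_le_pos.
have [A [A0 growth]] := exp_deletion_growth Q0 E0.
(* The sum meets at once the three lower bounds on [C] that the iteration requires. *)
pose C := (2 * A + INR Q + 1)%R.
have Qp := pos_INR Q.
have [AC C1 QC] : [/\ (2 * A <= C)%R, (1 <= C)%R & (INR Q <= C)%R].
  by rewrite /C; split; lra.
have [X largeX] := iter_log_large (C * C) E.
have [N [NX _]] : exists N, (Rmax 1 X <= INR N /\ INR N <= Rmax 1 X + 1)%R.
  by apply: exists_INR_between; have := Rmax_l 1 X; lra.
exists C; split; first by rewrite /C; lra.
exists N => n /leP/le_INR Nn r _ cr t [M [oM Mr]].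
have large j : j <= E -> (C * C <= iter_log j (INR n))%R.
  by move=> jE; apply: largeX jE; have := Rmax_r 1 X; lra.
have n1 : (1 <= INR n)%R by have := Rmax_l 1 X; lra.
have n0 : 0 < n by apply/ltP/INR_lt => /=; lra.
have x0 : (0 < iter_log E (INR n))%R.
  by have := large _ (leqnn E); nra.
apply: Rnot_lt_le => tC.
apply: (no_dense_sequence D0 n0 A0 AC C1 QC large growth
  (pairwise_precedes oM)).
- move=> _ /mapP[i _ ->]; have mM : is_matching (M i) by case: oM => mM _.
  split=> //; rewrite (card_matched mM) Mr.
  (* A matching covers [2 * r] vertices; already [D * r >= n], as [D >= / c] and [r >= c * n]. *)
  apply: leq_trans (_ : D * r <= _); last by rewrite leq_mul2l; lia.
  apply/leP/INR_le; rewrite mult_INR.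
  apply: Rle_trans (Rmult_le_compat_r _ _ _ (pos_INR r) cD).
  apply: (Rmult_le_reg_l c) => //; rewrite -Rmult_assoc Rinv_r ?Rmult_1_l //; lra.
- rewrite size_map size_enum_ord -/E; apply: Rlt_le.
  set x := iter_log E (INR n) in tC x0 *.
  have C0 : (0 < C)%R by rewrite /C; lra.
  have -> : INR n = (C * (INR n / x) * (x / C))%R by field; lra.
  by apply: Rmult_lt_compat_r => //; apply: Rdiv_lt_0_compat.
Qed.
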